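(* Let $N$ be a positive integer, $t_{\min}\le t_{\max}$ real numbers, and let $v$ be a point in the convex hull of $C_N$. For each positive integer or positive half-integer $M'$ such that $\frac{N+1}{2}-M'$ is a nonnegative integer, $v$ has at most one non-reducible $M'$-naming. Moreover, in total over all these possible values of $M'$, there is exactly one such non-reducible naming of $v$.
   Context: $C_N(t)=(t,t^2,\dots,t^N)\in\mathbb{R}^N$ for $t\in[t_{\min},t_{\max}]$, and the convex hull of $C_N$ is the convex hull of the image of this map. For a positive integer $M$, an $M$-naming of $v\in\mathbb{R}^N$ is a tuple $(c_1,\dots,c_M,t_1,\dots,t_M)$ of real numbers with $c_j\ge 0$, $\sum_{j=1}^M c_j=1$, $t_{\min}\le t_1\le t_2\le\dots\le t_M\le t_{\max}$ and $\sum_{j=1}^M c_jC_N(t_j)=v$. For a positive integer $M$, an $(M-\frac12)$-naming of $v$ is an $M$-naming of $v$ with $t_1=t_{\min}$. A positive half-integer is a number $M-\frac12$ with $M$ a positive integer. An $M$-naming ($M$ an integer) is reducible if $c_j=0$ for some $j\in\{1,\dots,M\}$ or $t_j=t_{j+1}$ for some $j\in\{1,\dots,M-1\}$. An $(M-\frac12)$-naming is reducible if $c_j=0$ for some $j\in\{2,\dots,M\}$ or $t_j=t_{j+1}$ for some $j\in\{1,\dots,M-1\}$ ($c_1=0$ alone does not make it reducible). Reducibility is always judged relative to the declared size $M'$. *)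

(* Defs.v *)
From HB Require Import structures.
From mathcomp Require Export all_boot all_order all_algebra.
From mathcomp Require Export classical_sets reals convex.

Set Implicit Arguments.
Unset Strict Implicit.
Unset Printing Implicit Defensive.
Import Order.TTheory GRing.Theory Num.Theory.
Local Open Scope classical_set_scope.
Local Open Scope ring_scope.

(* The i-th coordinate has exponent i.+1 because ordinals start at 0. *)
Definition moment_curve (R : realType) (N : nat) (t : R) : 'rV[R]_N :=
  \row_(i < N) t ^+ i.+1.

Definition convex_hull (R : realType) (N : nat) (A : set 'rV[R]_N) :
    set 'rV[R]_N :=
  smallest (@convex_set R 'rV[R]_N) A.

(* [Whole M] stands for the number M and [MinusHalf M] for M - 1/2.  In both
   cases a naming of that size has M weights and M parameters.  Positivity is
   not built in: it is the condition [0 < size_val s]. *)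
Variant naming_size := Whole of nat | MinusHalf of nat.

Definition size_val (s : naming_size) : rat :=
  match s with
  | Whole M => M%:R
  | MinusHalf M => M%:R - 1 / 2%:R
  end.

Definition size_len (s : naming_size) : nat :=
  match s with Whole M => M | MinusHalf M => M end.

Definition possible_size (N : nat) (s : naming_size) : Prop :=
  0 < size_val s /\ exists k : nat, (N + 1)%:R / 2%:R - size_val s = k%:R.

(* The pair (c, t) is the tuple (c_1, ..., c_M, t_1, ..., t_M). *)
Definition weighted_params (R : realType) (M : nat) : Type :=
  ('rV[R]_M * 'rV[R]_M)%type.

Definition int_naming (R : realType) (N : nat) (tmin tmax : R)
    (v : 'rV[R]_N) (M : nat) (n : weighted_params R M) : Prop :=
  let: (c, t) := n in
  [/\ forall j, 0 <= c 0 j,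
      \sum_j c 0 j = 1,
      forall j, tmin <= t 0 j <= tmax,
      forall i j : 'I_M, (i <= j)%N -> t 0 i <= t 0 j &
      \sum_j c 0 j *: moment_curve N (t 0 j) = v].

Definition is_naming (R : realType) (N : nat) (tmin tmax : R) (v : 'rV[R]_N)
    (s : naming_size) : weighted_params R (size_len s) -> Prop :=
  match s with
  | Whole M => fun n => int_naming tmin tmax v n
  | MinusHalf M => fun n => int_naming tmin tmax v n /\
      forall j : 'I_M, j = 0%N :> nat -> n.2 0 j = tmin
  end.

Definition reducible (R : realType) (s : naming_size) :
    weighted_params R (size_len s) -> Prop :=
  match s with
  | Whole M => fun n =>
      (exists j : 'I_M, n.1 0 j = 0) \/
      (exists i j : 'I_M, j = i.+1 :> nat /\ n.2 0 i = n.2 0 j)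
  | MinusHalf M => fun n =>
      (exists j : 'I_M, (0 < j)%N /\ n.1 0 j = 0) \/
      (exists i j : 'I_M, j = i.+1 :> nat /\ n.2 0 i = n.2 0 j)
  end.

Definition nonreducible_naming (R : realType) (N : nat) (tmin tmax : R)
    (v : 'rV[R]_N) (s : naming_size) (n : weighted_params R (size_len s)) :
    Prop :=
  is_naming tmin tmax v n /\ ~ reducible n.

(* Main.v *)
From HB Require Import structures.
Require Import Defs.
From Stdlib Require Import Eqdep_dec.
From mathcomp Require Import boolp interval_inference ring lra zify.
Import Order.TTheory GRing.Theory Num.Theory.
Local Open Scope classical_set_scope.
Local Open Scope ring_scope.
Set Implicit Arguments.
Unset Strict Implicit.
Unset Printing Implicit Defensive.

(* A naming is a finitely supported probability measure on [tmin, tmax] with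
   prescribed moments of order at most N.  Two namings of possible sizes have at
   most N + 1 nodes altogether (the common node tmin being counted once when N
   is even), so testing them against the polynomial of degree at most N that
   vanishes at all of these nodes but one shows that the measures agree.
   For existence, start from any finitely supported measure representing v.  If
   it has too many nodes and N is odd, replace it by its Gauss quadrature rule,
   whose nodes are the roots of an orthogonal polynomial; if N is even, use the
   Gauss-Radau rule with fixed node tmin, obtained from the Gauss rule of the
   measure weighted by x - tmin. *)

(** * Finite quadrature sums as linear forms on polynomials *)

Definition quad (R : comNzRingType) (l : seq R) (w : R -> R) (f : {poly R}) : R :=
  \sum_(x <- l) w x * f.[x].

Section Quad.
Variables (R : comNzRingType) (l : seq R) (w : R -> R).

Lemma quad_is_linear : linear_for *%R (quad l w).
Proof.
move=> c f g; rewrite /quad mulr_sumr -big_split; apply: eq_bigr => x _ /=.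
by rewrite hornerD hornerZ mulrDr mulrCA.
Qed.

HB.instance Definition _ :=
  GRing.isLinear.Build R {poly R} R *%R (quad l w) quad_is_linear.

End Quad.

Section QuadOrder.
Variables (R : realFieldType) (l : seq R) (w : R -> R).
Hypothesis w_gt0 : {in l, forall x, 0 < w x}.

Lemma quad_ge0 f : {in l, forall x, 0 <= f.[x]} -> 0 <= quad l w f.
Proof.
by move=> f0; rewrite /quad big_seq sumr_ge0 // => x xl;
  rewrite mulr_ge0 ?f0 ?ltW ?w_gt0.
Qed.

Lemma quad_eq0 f :
  {in l, forall x, 0 <= f.[x]} -> quad l w f = 0 -> all (root f) l.
Proof.
move=> f0 /eqP; rewrite /quad big_seq psumr_eq0; last first.
  by move=> x xl; rewrite mulr_ge0 ?f0 ?ltW ?w_gt0.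
move/allP => h; apply/allP => x xl; have := h x xl.
by rewrite xl /= mulf_eq0 gt_eqF ?w_gt0.
Qed.

End QuadOrder.

Lemma poly_sum_wide (R : nzRingType) (n : nat) (p : {poly R}) :
  (size p <= n)%N -> p = \sum_(i < n) p`_i *: 'X^i.
Proof.
by move=> sp; rewrite -[LHS](poly_rV_K sp) -poly_def; apply/polyP=> i;
  rewrite coef_poly coef_rVpoly; case: insubP => [j /= -> <-|/negbTE ->//];
    rewrite mxE.
Qed.

(** Orthogonality to the powers ['X^k], [k < m], is [m] linear conditions on [m + 1] coefficients,
    so their matrix has a nonzero left kernel. *)
Lemma quad_orthogonal (F : fieldType) (l : seq F) (w : F -> F) (m : nat) :
  exists P : {poly F}, [/\ P != 0, (size P <= m.+1)%N &
    forall Q : {poly F}, (size Q <= m)%N -> quad l w (P * Q) = 0].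
Proof.
pose A := \matrix_(i < m.+1, k < m) quad l w ('X^i * 'X^k).
have /rowV0Pn[u /sub_kermxP uA u0] : kermx A != 0.
  by rewrite -mxrank_eq0 mxrank_ker subn_eq0 -ltnNge ltnS rank_leq_col.
exists (rVpoly u); split; last move=> Q sQ.
- by rewrite raddf_eq0 //; exact: can_inj rVpolyK.
- exact: size_poly.
rewrite [Q](poly_sum_wide sQ) mulr_sumr linear_sum big1 // => k _ /=.
rewrite -scalerAr linearZ /= {1}[u]row_sum_delta linear_sum mulr_suml linear_sum /=.
apply/eqP; rewrite mulf_eq0; apply/orP; right; apply/eqP.
transitivity ((u *m A) 0 k); last by rewrite uA mxE.
rewrite mxE; apply: eq_bigr => i _.
by rewrite linearZ /= rVpoly_delta -scalerAl linearZ /= mxE.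
Qed.

(** * Sign changes, Gauss and Gauss-Radau quadrature *)

Section RealClosed.
Variable R : rcfType.
Implicit Types (P Q : {poly R}) (a b x y : R) (l s : seq R).

Lemma poly_ivt_strict P a b u v : a <= u <= b -> a <= v <= b ->
  P.[u] < 0 < P.[v] -> exists2 x, a < x < b & root P x.
Proof.
move=> /andP[au ub] /andP[av vb] /andP[Pu Pv].
wlog uv : P u v au ub av vb Pu Pv / u <= v => [wl|].
  have [/wl|/ltW vu] := leP u v; first exact.
  have [||x xab] := wl (- P) v u av vb au ub _ _ vu.
  - by rewrite hornerN oppr_lt0.
  - by rewrite hornerN oppr_gt0.
  by rewrite rootN; exists x.
have [|x /andP[ux xv] rx] := @poly_ivt R P u v uv; first by rewrite !ltW.
exists x => //; move/rootP: rx => rx; apply/andP; split.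
  apply: (le_lt_trans au); rewrite lt_neqAle ux andbT.
  by apply: contraTneq Pu => ->; rewrite rx ltxx.
apply: (lt_le_trans _ vb); rewrite lt_neqAle xv andbT.
by apply: contraTneq Pv => <-; rewrite rx ltxx.
Qed.

(* [s] is the set of roots of odd multiplicity of [P] between [a] and [b]. *)
Lemma sign_changes P a b : P != 0 ->
  exists s, [/\ uniq s, all (root P) s, all (fun x => a < x < b) s &
    exists e : bool, forall x, a <= x <= b ->
      0 <= (-1) ^+ e * (P * \prod_(y <- s) ('X - y%:P)).[x]].
Proof.
have [n] := ubnP (size P); elim: n P => // n IH P sP P0.
(* If [P] does not take both strict signs on [[a, b]], the empty list works; otherwise a root is
   split off and the quotient is treated by induction. *)
have [[u [v [uab vab Puv]]]|noSC] := pselect (exists u v,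
    [/\ a <= u <= b, a <= v <= b & P.[u] < 0 < P.[v]]); last first.
  exists [::]; split=> //; rewrite big_nil mulr1.
  have [[u uab Pu]|noN] := pselect (exists2 u, a <= u <= b & P.[u] < 0).
    exists true => v vab; rewrite mulN1r oppr_ge0 leNgt; apply/negP => Pv.
    by apply: noSC; exists u, v; rewrite Pu.
  exists false => v vab; rewrite mul1r leNgt; apply/negP => Pv.
  by apply: noN; exists v.
have [x xab /factor_theorem[Q PQ]] := poly_ivt_strict uab vab Puv.
have Q0 : Q != 0 by apply: contraNneq P0 => Q0; rewrite PQ Q0 mul0r.
have [||s [us rs sab [e He]]] := IH Q => //.
  by rewrite -ltnS; move: sP;
    rewrite PQ size_Mmonic ?monicXsubC // size_XsubC addn2.
have rsP : all (root P) s by apply: sub_all rs => y ry; rewrite PQ rootM ry.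
(* If [x] has odd multiplicity in [Q], its multiplicity in [P] is even and it leaves the list.
   Otherwise it joins, and contributes a harmless square. *)
have [xs|xs] := boolP (x \in s).
  exists (rem x s); split.
  - exact: rem_uniq.
  - by apply/allP => y /mem_rem; exact: (allP rsP).
  - by apply/allP => y /mem_rem; exact: (allP sab).
  exists e => y /He; rewrite (perm_big _ (perm_to_rem xs)) big_cons /= PQ.
  by rewrite mulrA.
exists (x :: s); split.
- by rewrite /= xs.
- by rewrite /= rsP andbT PQ rootM root_XsubC eqxx orbT.
- by rewrite /= xab.
exists e => y /He h; rewrite big_cons PQ.
have -> : Q * ('X - x%:P) * (('X - x%:P) * \prod_(j <- s) ('X - j%:P)) =
   ('X - x%:P) ^+ 2 * (Q * \prod_(j <- s) ('X - j%:P)) by ring.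
by rewrite hornerM mulrCA mulr_ge0 // horner_exp sqr_ge0.
Qed.

(** The nodes are the sign changes of the orthogonal polynomial [P], and the weights are the values
    of [quad l w] on the Lagrange basis [L] of these nodes. *)
Lemma gauss_quadrature l w a b m :
  all (fun x => a <= x <= b) l -> uniq l -> {in l, forall x, 0 < w x} ->
  (m < size l)%N ->
  exists s w', [/\ uniq s, size s = m, all (fun x => a < x < b) s,
    {in s, forall x, 0 < w' x} &
    forall f : {poly R}, (size f <= m.*2)%N -> quad l w f = quad s w' f].
Proof.
move=> lab ul w0 ml.
have [P [P0 sP orthP]] := quad_orthogonal l w m.
have nroot (Q : {poly R}) : Q != 0 -> (size Q <= size l)%N -> ~~ all (root Q) l.
  by move=> Q0 sQ; apply: contra Q0 => h; rewrite (roots_geq_poly_eq0 h).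
have [s [us rs sab [e He]]] := sign_changes a b P0.
have ssP : (size s < size P)%N by exact: max_poly_roots.
have sm : size s = m.
  apply/eqP; rewrite eqn_leq -ltnS (leq_trans ssP sP) /= leqNgt; apply/negP => sm.
  (* With fewer than [m] sign changes [Q] is small enough to be orthogonal to [P], yet [P * Q] has
     constant sign on [l], so it vanishes there. Roots of [Q] are roots of [P], so [P] has more
     roots than its degree allows. *)
  pose Q := \prod_(y <- s) ('X - y%:P).
  have : all (root ((-1) ^+ e *: (P * Q))) l.
    apply: (quad_eq0 w0) => [x xl|];
      last by rewrite linearZ /= orthP ?mulr0 // size_prod_XsubC.
    by rewrite hornerZ He // (allP lab).
  move/allP => h; move: (nroot P P0);
    rewrite (leq_trans sP ml) => /(_ isT) /negP; apply.
  apply/allP => x /h; rewrite rootZ ?signr_eq0 // rootM => /orP[//|].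
  by rewrite root_prod_XsubC; exact: (allP rs).
have szP : size P = m.+1 by apply/eqP; rewrite eqn_leq sP -sm.
pose q x : {poly R} := \prod_(y <- rem x s) ('X - y%:P).
have qE x y : x \in s -> y \in s -> (q x).[y] != 0 = (y == x).
  move=> xs ys; rewrite -/(root _ _) root_prod_XsubC (mem_rem_uniq _ us) inE ys
    andbT.
  by rewrite negbK.
have sq x : x \in s -> size (q x) = m.
  by move=> xs; rewrite size_prod_XsubC size_rem // sm prednK // -sm; case: (s) xs.
pose L x := (q x).[x]^-1 *: q x.
have LE x y : x \in s -> y \in s -> (L x).[y] = (y == x)%:R.
  move=> xs ys; rewrite hornerZ; have [->|yx] := eqVneq y x.
    by rewrite mulVf // qE.
  by apply/eqP; rewrite mulf_eq0 -[_.[y] == 0]negbK qE // yx orbT.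
have sL x : x \in s -> (size (L x) <= m)%N.
  by move=> xs; rewrite (leq_trans (size_scale_leq _ _)) // sq.
(* Division by [P]: orthogonality removes the quotient part, and the remainder is the Lagrange
   interpolant of [f], since [P] vanishes on [s]. *)
have exact (f : {poly R}) : (size f <= m.*2)%N -> quad l w f = quad s (fun x =>
  quad l w (L x)) f.
  move=> sf; pose r := f %% P.
  have sr : (size r <= m)%N by rewrite -ltnS -szP ltn_modp.
  have fr x : x \in s -> f.[x] = r.[x].
    move=> xs; rewrite [in LHS](divp_eq f P) hornerD hornerM.
    by have /rootP -> := allP rs x xs; rewrite mulr0 add0r.
  have rE : r = \sum_(x <- s) f.[x] *: L x.
    apply/eqP; rewrite -subr_eq0; apply/eqP;
      apply: (@roots_geq_poly_eq0 _ _ s) => //.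
      apply/allP => y ys; apply/rootP; rewrite hornerD hornerN horner_sum.
      rewrite (bigD1_seq y) //= hornerZ LE // eqxx mulr1 fr //
        big_seq_cond big1 ?addr0 ?subrr //.
      by move=> x /andP[xs xy]; rewrite hornerZ LE // eq_sym (negbTE xy) mulr0.
    rewrite sm; apply: (leq_trans (size_polyD _ _)); rewrite geq_max sr size_polyN.
    apply: (leq_trans (size_sum _ _ _)); apply/bigmax_leqP_seq => x xs _.
    by rewrite (leq_trans (size_scale_leq _ _)) ?sL.
  rewrite [in LHS](divp_eq f P) mulrC linearD /= orthP ?add0r; last first.
    by rewrite size_divp // szP /= leq_subLR addnn.
  rewrite -/r rE linear_sum; apply: eq_bigr => x _.
  by rewrite linearZ /= mulrC.
exists s, (fun x => quad l w (L x)); split=> // x xs.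
have m0 : (0 < m)%N by rewrite -sm; case: (s) xs.
have Lsq y : 0 <= (L x ^+ 2).[y] by rewrite horner_exp sqr_ge0.
(* [L x] and its square agree at the nodes, so the weight of [x] is positive. *)
have LxE : quad l w (L x) = quad l w (L x ^+ 2).
  rewrite (exact (L x ^+ 2)); last first.
    rewrite (leq_trans (size_exp_leq _ _)) //.
    by move: (size _) (sL x xs) => k; lia.
  rewrite [RHS](bigD1_seq x) //= horner_exp LE //
    eqxx expr1n mulr1 big_seq_cond big1 ?addr0 //.
  by move=> y /andP[ys yx]; rewrite horner_exp LE // (negbTE yx) expr0n mulr0.
rewrite LxE lt_def quad_ge0 // andbT; apply/eqP => /quad_eq0.
case/(_ w0 (fun _ _ => Lsq _)) => /allP h.
have Lx0 : L x != 0.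
  by apply/eqP => Lx0; have := LE x x xs xs;
    rewrite Lx0 horner0 eqxx => /esym/eqP; rewrite oner_eq0.
have /negP := nroot _ Lx0 (leq_trans (sL x xs) (ltnW ml)); apply.
by apply/allP => y /h; rewrite /root horner_exp expf_eq0.
Qed.

End RealClosed.

(** The Gauss rule is taken for the weights [w x * (x - a)], positive on the nodes other than [a].
    Dividing the new weights by [x - a] undoes the change, and [a] receives the mass that makes
    constants exact. *)
Lemma radau_quadrature (R : rcfType) (l : seq R) w a b p :
  all (fun x => a <= x <= b) l -> uniq l -> {in l, forall x, 0 < w x} ->
  (p < count (predC1 a) l)%N ->
  exists s w', [/\ uniq s, size s = p, all (fun x => a < x < b) s,
    {in s, forall x, 0 < w' x} /\ 0 <= w' a &
    forall f : {poly R}, (size f <= p.*2.+1)%N ->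
      quad l w f = quad (a :: s) w' f].
Proof.
move=> /allP lab ul w0; rewrite -size_filter; set l0 := filter _ l => pl.
have l0a x : x \in l0 -> 0 < x - a.
  rewrite mem_filter /= => /andP[xa /lab/andP[ax _]].
  by rewrite subr_gt0 lt_neqAle eq_sym xa.
have [||x|s [u [us ss sab u0 Hu]]] := @gauss_quadrature R l0 (fun x =>
  w x * (x - a)) a b p _ _ _ pl.
- by apply/allP => x; rewrite mem_filter => /andP[_ /lab].
- exact: filter_uniq.
- by move=> xl; rewrite mulr_gt0 ?l0a // w0 // (mem_subseq (filter_subseq _ _) xl).
have sa x : x \in s -> 0 < x - a.
  by move=> /(allP sab) /andP[ax _]; rewrite subr_gt0.
pose w1 x := u x / (x - a).
pose wa := quad l w 1 - \sum_(x <- s) w1 x.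
pose w' x := if x == a then wa else w1 x.
have w'E x : x \in s -> w' x = w1 x.
  by rewrite /w' => /sa; case: eqVneq => // ->; rewrite subrr ltxx.
have exact (f : {poly R}) : (size f <= p.*2.+1)%N -> quad l w f =
  quad (a :: s) w' f.
  move=> sf.
  (* Subtracting [f.[a]] leaves a multiple of ['X - a%:P], whose cofactor [g] is small enough for
     the Gauss rule. *)
  have /factor_theorem[g fg] : root (f - f.[a]%:P) a by rewrite /root !hornerE
    subrr.
  have sg : (size g <= p.*2)%N.
    have [->|g0] := eqVneq g 0; first by rewrite size_poly0.
    have : (size (f - f.[a]%:P)%R <= p.*2.+1)%N.
      apply: leq_trans (size_polyD _ _) _; rewrite geq_max sf size_polyN.
      exact: leq_trans (size_polyC_leq1 _) _.
    by rewrite fg size_Mmonic ?monicXsubC // size_XsubC addn2.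
  have fE x : f.[x] = f.[a] * 1 + g.[x] * (x - a).
    move/(congr1 (horner^~ x)): fg;
      rewrite hornerM !hornerD !hornerN hornerX !hornerC => /eqP;
        rewrite subr_eq => /eqP ->; ring.
  have -> : quad l w f = f.[a] * quad l w 1 + quad l0 (fun x => w x * (x - a)) g.
    rewrite /quad big_filter mulr_sumr [X in _ = _ + X]big_mkcond -big_split /=.
    apply: eq_bigr => x _; rewrite hornerC (fE x) /=.
    by case: eqVneq => [->|_]; rewrite ?subrr /=; ring.
  rewrite Hu // /quad big_cons {1}/w' eqxx /wa.
  rewrite mulrBl mulrC -addrA; congr (_ + _).
  rewrite mulr_suml -sumrN -big_split; apply: eq_big_seq => x xs /=.
  rewrite w'E // /w1 (fE x).  field.
  by rewrite gt_eqF ?sa.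
exists s, w'; split => //; split.
  by move=> x xs; rewrite w'E // divr_gt0 ?sa ?u0.
(* This square vanishes on [s] and is positive at [a], and the rule is exact on it, so it isolates
   the weight at [a]. *)
pose f := (\prod_(y <- s) ('X - y%:P)) ^+ 2.
have sf : (size f <= p.*2.+1)%N.
  by apply: (leq_trans (size_exp_leq _ _)); rewrite size_prod_XsubC ss muln2.
have : 0 <= quad l w f by apply: quad_ge0 => // x _; rewrite horner_exp sqr_ge0.
rewrite exact // /quad big_cons big_seq big1 ?addr0.
  rewrite pmulr_lge0 //.
  rewrite horner_exp exprn_even_gt0 //= -/(root _ _) root_prod_XsubC.
  by apply/negP => /sa; rewrite subrr ltxx.
move=> x xs; apply/eqP; rewrite mulf_eq0 horner_exp expf_eq0 /=.
by rewrite -/(root _ _) root_prod_XsubC xs orbT.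
Qed.

(** * Comparison of measures with different node lists, by extension with zero *)

Definition mass (R : comNzRingType) (l : seq R) (w : R -> R) (x : R) : R :=
  if x \in l then w x else 0.

Lemma quad_mass (R : comNzRingType) (l l' : seq R) w (f : {poly R}) :
  uniq l -> uniq l' -> {subset l <= l'} -> quad l' (mass l w) f = quad l w f.
Proof.
move=> ul ul' sl.
rewrite /quad (bigID (mem l)) /= addrC big1 ?add0r; last first.
  by move=> x /negbTE xl; rewrite /mass xl mul0r.
rewrite -big_filter (perm_big l); first by apply: eq_big_seq => x xl;
  rewrite /mass xl.
apply: uniq_perm => //; first exact: filter_uniq.
by move=> x; rewrite mem_filter /=; have [/sl|] := boolP (x \in l).
Qed.

(** The product of the factors of all nodes other than [x] has size at most [n], and reads off the
    mass at [x] up to a nonzero factor. *)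
Lemma mass_unique (R : idomainType) (l1 l2 : seq R) w1 w2 n :
  uniq l1 -> uniq l2 -> (size (undup (l1 ++ l2)) <= n)%N ->
  (forall f : {poly R}, (size f <= n)%N -> quad l1 w1 f = quad l2 w2 f) ->
  mass l1 w1 =1 mass l2 w2.
Proof.
move=> u1 u2 sn H x; set U := undup _ in sn.
have uU : uniq U by exact: undup_uniq.
have [xU|] := boolP (x \in U); last first.
  by rewrite mem_undup mem_cat negb_or /mass => /andP[/negbTE -> /negbTE ->].
pose f := \prod_(y <- rem x U) ('X - y%:P).
have sf : (size f <= n)%N.
  by rewrite size_prod_XsubC size_rem // prednK //; case: (U) xU.
have s1 : {subset l1 <= U} by move=> y yl; rewrite mem_undup mem_cat yl.
have s2 : {subset l2 <= U} by move=> y yl; rewrite mem_undup mem_cat yl orbT.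
have fx : f.[x] != 0 by rewrite -/(root _ _) root_prod_XsubC mem_rem_uniqF.
have qE w : quad U w f = w x * f.[x].
  rewrite /quad (bigD1_seq x) //= big_seq_cond big1 ?addr0 // => y /andP[yU yx].
  have /rootP -> : root f y by rewrite root_prod_XsubC mem_rem_uniq // inE yx.
  by rewrite mulr0.
apply: (mulIf fx); rewrite -!qE !quad_mass //; exact: H.
Qed.

(** * Moment representations of the points of the convex hull *)

Section Lists.
Variables (R : realType) (N : nat) (v : 'rV[R]_N).

(** On polynomials of degree at most [N], this is the integral against any probability measure with
    moment vector [v]. *)
Definition moment_functional (f : {poly R}) : R :=
  f`_0 + \sum_(i < N) f`_i.+1 * v 0 i.

Definition represents (l : seq R) (w : R -> R) : Prop :=
  forall f : {poly R}, (size f <= N.+1)%N -> quad l w f = moment_functional f.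

Lemma representsP l w :
  represents l w <->
  \sum_(x <- l) w x = 1 /\ \sum_(x <- l) w x *: moment_curve N x = v.
Proof.
split=> [H|[H1 Hv] f sf].
  split.
    have := H 1; rewrite size_poly1 => /(_ isT); rewrite /quad /moment_functional.
    under eq_bigr do rewrite hornerC mulr1.
    move=> ->; rewrite coef1 big1 ?addr0 // => i _.
    by rewrite coef1 mul0r.
  apply/rowP => i; rewrite summxE.
  have := H 'X^(i.+1); rewrite size_polyXn ltnS ltn_ord => /(_ isT).
  rewrite /quad /moment_functional coefXn add0r (bigD1 i) //= coefXn eqxx mul1r
    [X in v 0 i + X]big1 ?addr0.
    by move=> <-; apply: eq_bigr => x _; rewrite !mxE hornerXn.
  by move=> j ji; rewrite coefXn eqSS (inj_eq val_inj) (negbTE ji) mul0r.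
rewrite /quad /moment_functional -[f`_0]mulr1 -H1 -Hv mulr_sumr.
under [X in _ = _ + X]eq_bigr do rewrite summxE mulr_sumr.
rewrite exchange_big -big_split; apply: eq_bigr => x _ /=.
rewrite (horner_coef_wide x sf) big_ord_recl /= expr0 mulr1 mulrDr mulrC;
  congr (_ + _).
by rewrite mulr_sumr; apply: eq_bigr => i _; rewrite !mxE mulrCA.
Qed.

End Lists.

(** The points represented with nonnegative weights form a convex set containing the curve, hence
    the hull. Nodes of weight zero are discarded at the end. *)
Lemma hull_represented (R : realType) (N : nat) (a b : R) (v : 'rV[R]_N) :
  convex_hull (@moment_curve R N @` [set t : R | a <= t <= b]) v ->
  exists l w, [/\ uniq l, all (fun x => a <= x <= b) l,
    {in l, forall x, 0 < w x} & represents v l w].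
Proof.
pose H : set 'rV[R]_N := [set v | exists l w, [/\ uniq l,
  all (fun x => a <= x <= b) l, {in l, forall x, 0 <= w x} & represents v l w]].
move=> vh; have : H v.
  apply: (smallest_sub _ _ vh) => {v vh}; last first.
    move=> _ [t tab <-]; exists [:: t], (fun=> 1); split => //=.
    - by rewrite tab.
    - by apply/representsP; rewrite !big_seq1 scale1r.
  apply/convex_setW => x y; rewrite !inE.
  move=> [l1 [w1 [u1 ab1 p1 r1]]] [l2 [w2 [u2 ab2 p2 r2]]] k k0 k1.
  rewrite inE.
  pose l := undup (l1 ++ l2).
  have ul : uniq l by exact: undup_uniq.
  pose w x := k%:num * mass l1 w1 x + (1 - k%:num) * mass l2 w2 x.
  have k1' : 0 <= 1 - k%:num by rewrite subr_ge0 ltW.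
  exists l, w; split => //.
  - by apply/allP => t; rewrite mem_undup mem_cat => /orP[/(allP ab1)|/(allP ab2)].
  - have m0 l' w' t : {in l', forall x, 0 <= w' x} -> 0 <= mass l' w' t.
      by move=> h; rewrite /mass; case: ifP => // /h.
    by move=> t _; rewrite addr_ge0 // mulr_ge0 ?m0 // ltW.
  move=> f sf.
  have -> : quad l w f = k%:num * quad l1 w1 f + (1 - k%:num) * quad l2 w2 f.
    rewrite -(quad_mass w1 f u1 ul); last by move=> t tl;
      rewrite mem_undup mem_cat tl.
    rewrite -(quad_mass w2 f u2 ul); last by move=> t tl;
      rewrite mem_undup mem_cat tl orbT.
    by rewrite /quad !mulr_sumr -big_split; apply: eq_bigr => t _; rewrite /w /=;
      ring.
  rewrite r1 // r2 // /moment_functional.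
  have -> : (conv k x y : 'rV[R]_N) =
    k%:num *: (x : 'rV[R]_N) + (1 - k%:num) *: (y : 'rV[R]_N) by [].
  under [in RHS]eq_bigr do rewrite !mxE mulrDr.
  rewrite big_split /= !mulrDr !mulr_sumr.
  under [in RHS]eq_bigr do rewrite mulrCA.
  under [X in _ = _ + (_ + X)]eq_bigr do rewrite mulrCA.
  ring.
case=> l [w [ul abl w0 r]]; exists [seq x <- l | w x != 0], w; split.
- exact: filter_uniq.
- by apply/allP => x; rewrite mem_filter => /andP[_ /(allP abl)].
- by move=> x; rewrite mem_filter lt_def => /andP[-> /w0].
move=> f /r <-; rewrite /quad big_filter [RHS](bigID (fun x => w x != 0)) /=.
by rewrite [X in _ = _ + X]big1 ?addr0 // => x; rewrite negbK => /eqP ->;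
  rewrite mul0r.
Qed.

(** * Existence and uniqueness of normalized representations *)

Section Normalized.
Variables (R : realType) (N : nat) (a b : R) (v : 'rV[R]_N).

(* Nonreducible namings of possible size, with the weights as a function on [R]
   so that the number of nodes does not occur in the type. *)
Definition normalized (l : seq R) (w : R -> R) : Prop :=
  [/\ sorted <%R l /\ (0 < size l <= N./2.+1)%N, (~~ odd N -> l`_0 = a),
      {in l, forall x, a <= x <= b} /\ {in l, forall x, 0 <= w x},
      (forall i, (i < size l)%N -> odd N || (0 < i)%N -> w l`_i != 0) &
      represents v l w].

Lemma represents_size_gt0 l w : represents v l w -> (0 < size l)%N.
Proof.
case/representsP; case: l => //; rewrite big_nil => /eqP.
by rewrite eq_sym oner_eq0.
Qed.

Lemma normalized_unique l1 w1 l2 w2 :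
  normalized l1 w1 -> normalized l2 w2 -> l1 = l2 /\ {in l1, w1 =1 w2}.
Proof.
move=> n1 n2; have [[o1 s1] a1 _ _ r1] := n1; have [[o2 s2] a2 _ _ r2] := n2.
have u1 := lt_sorted_uniq o1; have u2 := lt_sorted_uniq o2.
have mE : mass l1 w1 =1 mass l2 w2.
  apply: (@mass_unique _ _ _ _ _ N.+1) => // [|f sf]; last by rewrite r1 // r2.
  (* For odd [N] each list has at most [(N + 1) / 2] nodes; for even [N] at most [N / 2 + 1], but
     the head [a] is shared. Either way the union has at most [N + 1]. *)
  have := size_undup (l1 ++ l2); rewrite size_cat.
  have [oN|eN] := boolP (odd N);
    first by move: (size (undup _)) (size l1) (size l2) s1 s2 oN => *; lia.
  have : (size (undup (l1 ++ l2)) < size (l1 ++ l2))%N.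
    rewrite ltn_size_undup cat_uniq u1 u2 /= andbT negbK; apply/hasP; exists a.
      by rewrite -a2 // mem_nth //; case/andP: s2.
    by rewrite -a1 //= mem_nth //; case/andP: s1.
  by rewrite size_cat; move: (size (undup _)) (size l1) (size l2) s1 s2 eN => *;
    lia.
(* A node of nonzero weight is visible in the mass. Only the head for even [N] may have weight 0,
   and it is [a], which also heads the other list. *)
have sub l w l' w' : normalized l w -> normalized l' w' ->
    mass l w =1 mass l' w' -> {subset l <= l'}.
  move=> [_ la _ l0 _] [[_ /andP[s' _]] la' _ _ _] e x xl.
  have [h|] := boolP (odd N || (0 < index x l)%N).
    have := l0 (index x l); rewrite index_mem nth_index // => /(_ xl h).
    by have := e x; rewrite /mass xl; case: ifP => // _ ->; rewrite eqxx.
  rewrite negb_or -eqn0Ngt => /andP[eN /eqP i0].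
  by rewrite -(nth_index 0 xl) i0 la // -la' // mem_nth.
have l12 : l1 = l2.
  apply: lt_sorted_eq => // x; apply/idP/idP; first exact: sub mE _.
  by apply: sub n2 n1 _ _ => y; rewrite mE.
by split=> // x xl; have := mE x; rewrite /mass -l12 xl.
Qed.

Lemma normalized_exists l w : uniq l -> all (fun x => a <= x <= b) l ->
  {in l, forall x, 0 < w x} -> represents v l w -> a <= b ->
  exists l' w', normalized l' w'.
Proof.
move=> ul lab w0 r ab.
have [oN|eN] := boolP (odd N).
  suff [s [u [us ss sab u0 ru]]] : exists s u, [/\ uniq s,
      (size s <= N./2.+1)%N, all (fun x => a <= x <= b) s,
      {in s, forall x, 0 < u x} & represents v s u].
    have ru' : represents v (sort <=%R s) u.
      move=> f /ru <-; apply: perm_big; exact/permEl/perm_sort.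
    exists (sort <=%R s), u; split => //.
    - by rewrite sort_lt_sorted (represents_size_gt0 ru') size_sort.
    - by rewrite oN.
    - by split=> x; rewrite mem_sort; [exact: (allP sab)|move=> /u0/ltW].
    - by move=> i il _; rewrite gt_eqF // u0 // -(mem_sort <=%R) mem_nth.
  have [sl|sl] := leqP (size l) N./2.+1; first by exists l, w.
  (* With [m = (N + 1) / 2] nodes the Gauss rule is exact up to size [2m = N + 1]. *)
  have [s [u [us ss sab u0 H]]] := gauss_quadrature lab ul w0 sl.
  exists s, u; split => //; first by rewrite ss.
    by apply: sub_all sab => x /andP[/ltW -> /ltW ->].
  by move=> f sf; rewrite -H ?r //; move: (size f) sf oN => *; lia.
(* For even [N] the node [a] is kept apart as the head, possibly with weight 0, and [s] holds the
   free nodes above it. *)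
suff [s [u [us [ss sab] u0 ua ru]]] : exists s u, [/\ uniq s,
    (size s <= N./2)%N /\ all (fun x => a < x <= b) s,
    {in s, forall x, 0 < u x}, 0 <= u a & represents v (a :: s) u].
  have sx x : x \in sort <=%R s -> a < x <= b by rewrite mem_sort => /(allP sab).
  exists (a :: sort <=%R s), u; split => //.
  - rewrite /= size_sort path_min_sorted ?sort_lt_sorted //.
    by apply/allP => x /sx /andP[].
  - split=> x; rewrite inE => /orP[/eqP->|]; rewrite ?lexx //.
      by move/sx => /andP[/ltW -> ->].
    by rewrite mem_sort => /u0/ltW.
  - rewrite (negbTE eN) => -[//|i] /= il _; rewrite gt_eqF // u0 //.
    by rewrite -(mem_sort <=%R) mem_nth.
  - move=> f /ru <-; apply: perm_big; rewrite perm_cons; exact/permEl/perm_sort.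
have [sl|sl] := leqP (count (predC1 a) l) N./2.
  (* [mass] gives the head [a] weight 0 when it is absent from [l]. *)
  exists [seq x <- l | x != a], (mass l w); split.
  - exact: filter_uniq.
  - rewrite size_filter; split => //; apply/allP => x; rewrite mem_filter.
    by case/andP=> xa /(allP lab) /andP[ax ->]; rewrite lt_neqAle eq_sym xa ax.
  - by move=> x; rewrite mem_filter /mass => /andP[_ xl]; rewrite xl w0.
  - by rewrite /mass; case: ifP => // /w0/ltW.
  move=> f /r <-; apply: quad_mass => //.
    by rewrite /= filter_uniq // andbT mem_filter eqxx.
  by move=> x xl; rewrite inE mem_filter xl andbT orbN.
(* With [N / 2] free nodes the Radau rule is exact up to size [2 * (N / 2) + 1 = N + 1]. *)
have [s [u [us ss sab [u0 ua] H]]] := radau_quadrature lab ul w0 sl.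
exists s, u; split => //.
  by split; [rewrite ss|apply: sub_all sab => x /andP[-> /ltW ->]].
by move=> f sf; rewrite -H ?r //; move: (size f) sf eN => *; lia.
Qed.

End Normalized.

(** * Arithmetic of the possible sizes: the parity of [N] decides their kind *)

Lemma possible_size_whole N M :
  possible_size N (Whole M) <-> odd N /\ (0 < M <= N./2.+1)%N.
Proof.
have halfE k : ((N + 1)%:R / 2%:R - M%:R == k%:R :> rat) = (N + 1 == (M + k) * 2)%N.
  rewrite -(eqr_nat rat) natrM !natrD; apply/eqP/eqP; lra.
rewrite /possible_size /= ltr0n; split.
  move=> [M0 [k /eqP]]; rewrite halfE => /eqP h.
  by rewrite M0; split; lia.
move=> [oN /andP[M0 MN]]; split => //; exists (N./2.+1 - M)%N.
by apply/eqP; rewrite halfE; apply/eqP; lia.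
Qed.

Lemma possible_size_minus_half N M :
  possible_size N (MinusHalf M) <-> ~~ odd N /\ (0 < M <= N./2.+1)%N.
Proof.
have pos : (0 < (M%:R - 1 / 2%:R : rat)) = (0 < M)%N.
  case: M => [|M] /=; first by rewrite sub0r oppr_gt0; apply/negbTE;
    rewrite -leNgt; lra.
  by rewrite -natr1 ltn0Sn; apply/idP; have := ler0n rat M;
    move: (M%:R : rat) => z; lra.
rewrite /possible_size /= pos.
(* The half moves to the other side, so [N + 2] is what must be even here. *)
have halfE k : ((N + 1)%:R / 2%:R - (M%:R - 1 / 2%:R) == k%:R :> rat) =
  (N + 2 == (M + k) * 2)%N.
  rewrite -(eqr_nat rat) natrM !natrD; apply/eqP/eqP; lra.
split.
  move=> [M0 [k /eqP]]; rewrite halfE => /eqP h.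
  by rewrite M0; split; lia.
move=> [oN /andP[M0 MN]]; split => //; exists (N./2.+1 - M)%N.
by apply/eqP; rewrite halfE; apply/eqP; lia.
Qed.

(** * Translation between normalized representations and namings *)

Section Pack.
Variables (R : realType) (N : nat) (a b : R) (v : 'rV[R]_N).

Definition row_params (l : seq R) (w : R -> R) : weighted_params R (size l) :=
  (\row_(j < size l) w l`_j, \row_(j < size l) l`_j).

(** The dependent pair allows namings of different sizes to be compared; for each parity of [N] only
    one constructor can give a possible size. *)
Definition pack (l : seq R) (w : R -> R) :
    {s : naming_size & weighted_params R (size_len s)} :=
  if odd N
  then existT (fun s => weighted_params R (size_len s)) (Whole (size l))
    (row_params l w)
  else existT (fun s => weighted_params R (size_len s)) (MinusHalf (size l))
    (row_params l w).

Lemma eq_pack l w1 w2 : {in l, w1 =1 w2} -> pack l w1 = pack l w2.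
Proof.
move=> e; suff: row_params l w1 = row_params l w2 by rewrite /pack => ->.
by congr pair; apply/rowP => j; rewrite !mxE e // mem_nth.
Qed.

Lemma int_naming_sorted M (n : weighted_params R M) :
  int_naming a b v n ->
  ~ (exists i j : 'I_M, j = i.+1 :> nat /\ n.2 0 i = n.2 0 j) ->
  forall i j : 'I_M, (i < j)%N -> n.2 0 i < n.2 0 j.
Proof.
case: n => c t [_ _ _ mon _] /= nred i j ij.
have iM : (i.+1 < M)%N by exact: leq_ltn_trans ij (ltn_ord j).
apply: (@lt_le_trans _ _ (t 0 (Ordinal iM))); last exact: mon.
rewrite lt_neqAle mon //= andbT; apply/eqP => e; apply: nred.
by exists i, (Ordinal iM).
Qed.

(** Distinct parameters make the weight a function of the parameter. The equality is one of pairs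
    because [size l] equals [M] only propositionally. *)
Lemma row_params_onto M (n : weighted_params R M) :
  injective (fun j => n.2 0 j) ->
  exists l w, existT (weighted_params R) M n =
    existT (weighted_params R) (size l) (row_params l w).
Proof.
case: n => c t /= tinj.
pose l := [seq t 0 j | j <- enum 'I_M].
pose w x := \sum_(j | t 0 j == x) c 0 j.
have sl : size l = M by rewrite size_map size_enum_ord.
have tE (j : 'I_M) : t 0 j = l`_j.
  by rewrite (nth_map j) ?size_enum_ord // nth_ord_enum.
have cE (j : 'I_M) : c 0 j = w l`_j.
  by rewrite -tE /w (big_pred1 j) // => i /=; rewrite (inj_eq tinj).
(* The bodies of [l] and [w] depend on [M] and must be forgotten before [M] can be replaced by
   [size l]. *)
exists l, w; move: tE cE; clearbody l w; subst M => tE cE.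
by congr existT; congr pair; apply/rowP => j; rewrite mxE.
Qed.

Lemma int_naming_row_params l w : sorted <%R l ->
  int_naming a b v (row_params l w) <->
  [/\ {in l, forall x, a <= x <= b}, {in l, forall x, 0 <= w x} &
      represents v l w].
Proof.
move=> sl.
have sumE (V : nmodType) (F : R -> V) :
    \sum_(x <- l) F x = \sum_(j < size l) F l`_j.
  by rewrite (big_nth 0) big_mkord.
split=> [[c0 c1 tab _ vE]|[lab w0 /representsP[c1 vE]]].
  split.
  - by move=> x /(nthP 0)[j jl <-]; have := tab (Ordinal jl); rewrite mxE.
  - by move=> x /(nthP 0)[j jl <-]; have := c0 (Ordinal jl); rewrite mxE.
  - apply/representsP; rewrite !sumE; split.
      by rewrite -[RHS]c1; apply: eq_bigr => j _; rewrite mxE.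
    by rewrite -[RHS]vE; apply: eq_bigr => j _; rewrite !mxE.
split.
- by move=> j; rewrite mxE w0 // mem_nth.
- by rewrite -[RHS]c1 sumE; apply: eq_bigr => j _; rewrite mxE.
- by move=> j; rewrite mxE lab // mem_nth.
- by move=> i j ij; rewrite !mxE lt_sorted_leq_nth ?inE.
- by rewrite -[RHS]vE sumE; apply: eq_bigr => j _; rewrite !mxE.
Qed.

Lemma nonreducible_sorted l w :
  int_naming a b v (row_params l w) ->
  ~ (exists i j : 'I_(size l), j = i.+1 :> nat /\
       (row_params l w).2 0 i = (row_params l w).2 0 j) ->
  sorted <%R l.
Proof.
move=> nm nred; apply/(sortedP 0) => i il.
have := int_naming_sorted nm nred (i := Ordinal (ltnW il)) (j := Ordinal il)
  (ltnSn i).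
by rewrite !mxE.
Qed.

Lemma sorted_nonrepeating l w : sorted <%R l ->
  ~ (exists i j : 'I_(size l), j = i.+1 :> nat /\
       (row_params l w).2 0 i = (row_params l w).2 0 j).
Proof.
move=> sl [i [j [ij]]]; rewrite !mxE => /eqP.
by rewrite nth_uniq ?ltn_ord ?lt_sorted_uniq // ij ltn_eqF.
Qed.

(** The weight exempted in [normalized] for even [N] is the [c_1] that may vanish in half-integer
    sizes; strict sorting amounts to weak order with distinct neighbours. *)
Lemma normalized_pack l w :
  normalized a b v l w <->
  possible_size N (projT1 (pack l w)) /\
  nonreducible_naming a b v (projT2 (pack l w)).
Proof.
rewrite /pack /normalized /nonreducible_naming.
have [oN|eN] := boolP (odd N) => /=; split.
- move=> [[sl szl] _ [lab w0] wn r]; split; first exact/possible_size_whole.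
  split; first by apply/int_naming_row_params.
  move=> [[j]|]; last exact: sorted_nonrepeating.
  by rewrite mxE => /eqP; rewrite (negbTE (wn _ _ _)).
- move=> [/possible_size_whole[_ szl] [nm nred]].
  have sl : sorted <%R l by apply: (nonreducible_sorted nm) => h; apply: nred;
    right.
  have [lab w0 r] := (int_naming_row_params _ sl).1 nm; split => // i il _.
  by apply/eqP => wi; apply: nred; left; exists (Ordinal il); rewrite mxE.
- move=> [[sl szl] la [lab w0] wn r]; split; first exact/possible_size_minus_half.
  split; first split; first by apply/int_naming_row_params.
    by move=> j j0; rewrite mxE j0 la.
  move=> [[j [j0]]|]; last exact: sorted_nonrepeating.
  by rewrite mxE => /eqP; rewrite (negbTE (wn _ _ _)).
- move=> [/possible_size_minus_half[_ szl] [[nm na] nred]].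
  have sl : sorted <%R l by apply: (nonreducible_sorted nm) => h; apply: nred;
    right.
  have [lab w0 r] := (int_naming_row_params _ sl).1 nm; split => //.
    by move=> _; have /andP[l0 _] := szl; have := na (Ordinal l0) erefl;
      rewrite mxE.
  move=> i il i0; apply/eqP => wi; apply: nred; left.
  by exists (Ordinal il); rewrite mxE.
Qed.

(** The possible size fixes the branch of [pack], and nonreducibility makes the parameters strictly
    increasing, hence injective, as [row_params_onto] requires. *)
Lemma pack_onto (x : {s : naming_size & weighted_params R (size_len s)}) :
  possible_size N (projT1 x) -> nonreducible_naming a b v (projT2 x) ->
  exists l w, x = pack l w.
Proof.
have inj M (n : weighted_params R M) : int_naming a b v n ->
    ~ (exists i j : 'I_M, j = i.+1 :> nat /\ n.2 0 i = n.2 0 j) ->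
    injective (fun j => n.2 0 j).
  move=> nm nred i j /= e.
  have h := int_naming_sorted nm nred.
  have [ij|ji|] := ltngtP i j.
  - by have := h i j ij; rewrite e ltxx.
  - by have := h j i ji; rewrite e ltxx.
  - exact: ord_inj.
case: x => -[] M n /=.
  move=> /possible_size_whole[oN _] [nm nred].
  have [|l [w e]] := row_params_onto (inj M n nm _); first by move=> h;
    apply: nred; right.
  exists l, w; rewrite /pack oN.
  exact: (congr1 (fun y => existT (fun s => weighted_params R (size_len s))
    (Whole (projT1 y)) (projT2 y)) e).
move=> /possible_size_minus_half[eN _] [[nm _] nred].
have [|l [w e]] := row_params_onto (inj M n nm _); first by move=> h;
  apply: nred; right.
exists l, w; rewrite /pack (negbTE eN).
exact: (congr1 (fun y => existT (fun s => weighted_params R (size_len s))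
  (MinusHalf (projT1 y)) (projT2 y)) e).
Qed.

End Pack.

Theorem lemma16 (R : realType) (N : nat) (tmin tmax : R) (v : 'rV[R]_N)
    (N_gt0 : (0 < N)%N) (le_tmin_tmax : tmin <= tmax)
    (v_hull : convex_hull (@moment_curve R N @`
                [set t : R | tmin <= t <= tmax]) v) :
  (forall s : naming_size, possible_size N s ->
     forall n1 n2 : weighted_params R (size_len s),
       nonreducible_naming tmin tmax v n1 ->
       nonreducible_naming tmin tmax v n2 -> n1 = n2) /\
  (exists! x : {s : naming_size & weighted_params R (size_len s)},
     possible_size N (projT1 x) /\
     nonreducible_naming tmin tmax v (projT2 x)).
Proof.
have uniq_naming (x1 x2 : {s : naming_size & weighted_params R (size_len s)}) :
    possible_size N (projT1 x1) /\ nonreducible_naming tmin tmax v (projT2 x1) ->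
    possible_size N (projT1 x2) /\ nonreducible_naming tmin tmax v (projT2 x2) ->
    x1 = x2.
  move=> h1 h2.
  have [l1 [w1 e1]] := pack_onto h1.1 h1.2;
    have [l2 [w2 e2]] := pack_onto h2.1 h2.2.
  move: h1 h2; rewrite e1 e2 => /normalized_pack n1 /normalized_pack n2.
  by have [<- /eq_pack] := normalized_unique n1 n2.
split.
  move=> s ps n1 n2 h1 h2.
  (* Uniqueness at a fixed size follows from equality of pairs: decidable equality of sizes, here
     classical, allows the common first component to be cancelled. *)
  have dec (x y : naming_size) : {x = y} + {x <> y} by exact: pselect.
  apply: (inj_pair2_eq_dec _ dec (fun s => weighted_params R (size_len s))).
  exact: uniq_naming.
have [l [w [ul lab w0 r]]] := hull_represented v_hull.
have [l' [w' n]] := normalized_exists ul lab w0 r le_tmin_tmax.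
exists (pack N l' w'); split; first exact/normalized_pack.
by move=> x; apply: uniq_naming; exact/normalized_pack.
Qed.
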